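(* Let $T>0$, $(k,l)\in\mathcal{PC}$, and let $f\in C(\mathbb{R})$ be nondecreasing. Suppose that $v,w\in W^{1,1}([0,T])$ satisfy $v(0)\le w(0)$ and $$\partial_t\big(k\ast[v-v(0)]\big)+f(v)\le0\quad\text{for a.a. }t\in(0,T),$$ $$\partial_t\big(k\ast[w-w(0)]\big)+f(w)\ge0\quad\text{for a.a. }t\in(0,T).$$ Then $v(t)\le w(t)$ for all $t\in[0,T]$.
   Context: $(k\ast v)(t)=\int_0^tk(t-\tau)v(\tau)\,d\tau$. $(k,l)\in\mathcal{PC}$ means: $k\in L_{1,loc}([0,\infty))$ is nonnegative and nonincreasing, $l\in L_{1,loc}([0,\infty))$, and $k\ast l=1$ on $(0,\infty)$. (It is known that then $l\ge0$.) *)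

(* Defs.v *)
From HB Require Import structures.
From mathcomp Require Import all_boot all_order all_algebra.
From mathcomp Require Import all_classical all_reals all_analysis.

Set Implicit Arguments.
Unset Strict Implicit.
Unset Printing Implicit Defensive.

Import Order.TTheory GRing.Theory Num.Theory.
Import numFieldNormedType.Exports.

Local Open Scope classical_set_scope.
Local Open Scope ring_scope.

(* Functions on a subset of the line are represented by total functions
   R -> R; their values off that subset play no role in the predicates below. *)

Section Definitions.
Variable R : realType.
Implicit Types (a b t T : R) (k l v g phi : R -> R) (D K : set R).

Local Notation mu := (@lebesgue_measure R).

Definition convolution k v t : R := \int[mu]_(tau in `[0, t]) (k (t - tau) * v tau).

(* The library's [locally_integrable] requires an open domain, hence does not
   apply to [0, +oo[. *)
Definition L1loc D k : Prop :=
  forall K, compact K -> K `<=` D -> mu.-integrable K (EFin \o k).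

(* A kernel in L_{1,loc}([0, +oo[) may be unbounded near 0, so sign and
   monotonicity are required on ]0, +oo[ only.  When convolution k l t = 1, the
   integrand is integrable: the integral would otherwise be 0. *)
Definition PC k l : Prop :=
  [/\ L1loc `[0, +oo[ k,
      forall t, 0 < t -> 0 <= k t,
      forall s t, 0 < s -> s <= t -> k t <= k s,
      L1loc `[0, +oo[ l &
      forall t, 0 < t -> convolution k l t = 1].

(* C^1_c(]a, b[) *)
Definition test_function a b phi : Prop :=
  [/\ forall x, derivable phi x 1,
      continuous (derive1 phi),
      compact (closure [set x | phi x != 0]) &
      closure [set x | phi x != 0] `<=` `]a, b[].

Definition weak_derivative a b v g : Prop :=
  forall phi, test_function a b phi ->
    \int[mu]_(x in `]a, b[) (v x * derive1 phi x) =
    - \int[mu]_(x in `]a, b[) (g x * phi x).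

(* W^{1,1} on the bounded interval [a, b]; as usual, an element is identified
   with its representative that is continuous on [a, b], which gives a meaning
   to its pointwise values. *)
Definition W11 a b v : Prop :=
  [/\ {within `[a, b], continuous v},
      mu.-integrable `]a, b[ (EFin \o v) &
      exists g, mu.-integrable `]a, b[ (EFin \o g) /\ weak_derivative a b v g].

End Definitions.

(* Main.v *)
Require Import Defs.
From HB Require Import structures.
From mathcomp Require Import all_boot all_order all_algebra.
From mathcomp Require Import all_classical all_reals all_analysis.
From mathcomp Require Import measurable_realfun ring lra.
Import Order.TTheory GRing.Theory Num.Theory.
Import numFieldNormedType.Exports.
Local Open Scope classical_set_scope.
Local Open Scope ring_scope.
Set Implicit Arguments.
Unset Strict Implicit.
Unset Printing Implicit Defensive.

(** Put u = v - w.  As u is absolutely continuous, Fubini's theorem gives that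
    k * (u - u(0)) is the primitive of an integrable function, which by Lebesgue
    differentiation and monotonicity of f is nonpositive a.e. where u > 0.  Hence
    k * (u - u(0)) decreases on the intervals on which u > 0.

    Let p = max(0, u) and P = k * p.  As k decreases, P decreases as well on the
    intervals on which u > 0.  If u(b) = 0, then p <= m(b) - m(a) on [a, b], where
    m is the primitive of |u'|, so that
    P(b) - P(a) <= (m(b) - m(a)) (k * 1)(b - a).  Going back to the last zero
    of u, this bound holds for all a <= b.  Summing it over a uniform partition of
    [0, t] whose mesh tends to 0 gives P(t) <= 0.  Finally, k * l = 1 forces
    k > 0 near 0, so P <= 0 implies p = 0. *)

(** * Lebesgue integrals on the line *)

Section Integration.
Context {R : realType}.
Local Notation mu := (@lebesgue_measure R).
Local Notation L1 f := (mu.-integrable [set: R] (EFin \o f)).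

(** Integrating from [-oo] avoids a choice of base point: functions are extended by zero to the
    line, and translations produce no boundary terms. *)
Definition primitive (f : R -> R) (x : R) : R :=
  \int[mu]_(t in `]-oo, x]) f t.

(** By uniqueness of Lebesgue measure it suffices to treat the intervals []b, c]], whose preimage
    [[a - c, a - b[] has the same length. *)
Lemma lebesgue_measure_reflect (a : R) (A : set R) : measurable A ->
  pushforward mu (fun x : measurableTypeR R => a - x : measurableTypeR R) A
  = mu A.
Proof.
have mphi : measurable_fun [set: measurableTypeR R]
    (fun x : measurableTypeR R => a - x : measurableTypeR R).
  by apply: measurable_funB => //; exact: measurable_id.
pose phi_mixin := isMeasurableFun.Build _ _ _ _ _ mphi.
pose phi : {mfun _ >-> _} := HB.pack
  (fun x : measurableTypeR R => a - x : measurableTypeR R) phi_mixin.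
move=> mA; apply/esym.
apply: (@lebesgue_measure_unique R (pushforward mu phi)) => //= _ [[b c]] _ <-.
rewrite /pushforward/=.
have -> : (fun x : R => a - x) @^-1` `]b, c] = `[a - c, a - b[%classic.
  by apply/seteqP; split => x /=; rewrite !in_itv/=; lra.
rewrite !lebesgue_measure_itv/= !lte_fin.
have -> : (a - c < a - b) = (b < c) by apply/idP/idP; lra.
by case: ifP => // _; rewrite -!EFinB; congr EFin; lra.
Qed.

Lemma measurable_reflect (a : R) :
  measurable_fun [set: R] (fun x : R => a - x).
Proof. by apply: measurable_funB => //; exact: measurable_id. Qed.

Lemma ge0_integral_reflect (a : R) (f : R -> \bar R) :
  measurable_fun [set: R] f -> (forall x, 0 <= f x)%E ->
  (\int[mu]_x f (a - x)%R = \int[mu]_x f x)%E.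
Proof.
move=> mf f0.
have := @ge0_integral_pushforward _ _ (measurableTypeR R) (measurableTypeR R) R
  _ (measurable_reflect a) mu setT f measurableT mf (fun y _ => f0 y).
rewrite preimage_setT => <-.
apply: eq_measure_integral; first exact: measurable_reflect.
by move=> ? A mA _; exact: lebesgue_measure_reflect.
Qed.

Lemma integrable_reflect (a : R) (f : R -> R) : L1 f -> L1 (fun x => f (a - x)).
Proof.
move=> /integrableP[mf foo]; apply/integrableP; split.
  exact: (measurableT_comp mf (measurable_reflect a)).
rewrite (@ge0_integral_reflect a (fun x => `|(EFin \o f) x|%E))//.
exact: measurableT_comp.
Qed.

Lemma Rintegral_reflect (a : R) (f : R -> R) : L1 f ->
  \int[mu]_x f (a - x) = \int[mu]_x f x.
Proof.
move=> f1; have mf := measurable_int _ f1; congr fine.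
have := @integral_pushforward _ _ (measurableTypeR R) (measurableTypeR R) R
  _ (measurable_reflect a) mu setT (EFin \o f) mf.
rewrite preimage_setT => <- //; last exact: integrable_reflect.
apply: eq_measure_integral; first exact: measurable_reflect.
by move=> ? A mA _; exact: lebesgue_measure_reflect.
Qed.

(** A translation is a composition of two reflections: [x - a = 0 - (a - x)]. *)
Lemma integrable_shift (a : R) (f : R -> R) : L1 f -> L1 (fun x => f (x - a)).
Proof.
move=> f1; have := integrable_reflect a (integrable_reflect 0 f1).
by apply: eq_integrable => // x _ /=; congr (f _)%:E; lra.
Qed.

Lemma Rintegral_shift (a : R) (f : R -> R) : L1 f ->
  \int[mu]_x f (x - a) = \int[mu]_x f x.
Proof.
move=> f1; rewrite -(Rintegral_reflect 0 f1).
rewrite -(Rintegral_reflect a (integrable_reflect 0 f1)).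
by apply: eq_Rintegral => x _; congr f; lra.
Qed.

Lemma integrableM_bounded (f g : R -> R) (M : R) : L1 f ->
  measurable_fun [set: R] g -> (forall x, `|g x| <= M) ->
  L1 (fun x => f x * g x).
Proof.
move=> f1 mg gM.
have -> : EFin \o (fun x => f x * g x) = ((EFin \o f) \* (EFin \o g))%E.
  by apply/funext => x /=; rewrite EFinM.
apply: integrableMl => //.
by exists M; split; [exact: num_real|move=> N MN x _; exact: le_trans (ltW MN)].
Qed.

Lemma integrableMcst (f : R -> R) (c : R) : L1 f -> L1 (fun x => f x * c).
Proof.
by move=> f1; apply: (integrableM_bounded (M := `|c|) f1 (measurable_cst c)).
Qed.

Lemma integrable_patch (f : R -> R) (D : set R) : measurable D ->
  mu.-integrable D (EFin \o f) -> L1 (f \_ D).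
Proof.
by move=> mD fD; rewrite -restrict_EFin; exact: (@integrable_mkcond _ _ _ mu D _ mD).1 fD.
Qed.

Lemma integrable_sub (f : R -> R) (D : set R) : measurable D ->
  L1 f -> mu.-integrable D (EFin \o f).
Proof. by move=> mD; apply: integrableS. Qed.

Lemma integrable_le (f g : R -> R) : measurable_fun [set: R] f -> L1 g ->
  (forall x, `|f x| <= g x) -> L1 f.
Proof.
move=> mf g1 fg; apply: le_integrable g1 => //; first exact/measurable_EFinP.
by move=> x _ /=; rewrite lee_fin (le_trans (fg x))// ler_norm.
Qed.

Lemma primitiveB (f : R -> R) (a b : R) : L1 f -> a <= b ->
  primitive f b - primitive f a = \int[mu]_(t in `]a, b]) f t.
Proof.
move=> f1 ab; rewrite /primitive Rintegral_itvB//.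
exact: integrable_sub.
Qed.

Lemma Rintegral_eq0 (D : set (measurableTypeR R)) (f : R -> R) :
  (forall x, D x -> f x = 0) -> \int[mu]_(x in D) f x = 0.
Proof. by move=> f0; rewrite /Rintegral integral0_eq// => x Dx; rewrite f0. Qed.

Lemma primitive_eq0 (f : R -> R) (a : R) :
  (forall x, x <= a -> f x = 0) -> primitive f a = 0.
Proof. by move=> f0; apply: Rintegral_eq0 => x /=; rewrite in_itv/=; exact: f0. Qed.

Lemma primitive_bound (f : R -> R) (a : R) : L1 f ->
  `|primitive f a| <= \int[mu]_x `|f x|.
Proof.
move=> f1; have nf1 : L1 (fun x => `|f x|) by exact: integrable_norm.
apply: (le_trans (le_normr_Rintegral _ _)) => //; first exact: integrable_sub.
rewrite Rintegral_mkcond; apply: le_Rintegral => //.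
  by apply: integrable_patch => //; exact: (integrable_sub _ nf1).
by move=> y _; rewrite patchE; case: ifP => _ /=; rewrite ?lexx ?normr_ge0.
Qed.

Lemma ge0_primitive_le (f : R -> R) (a b : R) : L1 f -> (forall x, 0 <= f x) ->
  a <= b -> primitive f a <= primitive f b.
Proof.
move=> f1 f0 ab; rewrite -subr_ge0 primitiveB//.
by apply: Rintegral_ge0.
Qed.

Lemma primitive_dist (f : R -> R) (a b : R) : L1 f -> a <= b ->
  `|primitive f b - primitive f a| <=
  primitive (fun x => `|f x|) b - primitive (fun x => `|f x|) a.
Proof.
move=> f1 ab; rewrite !primitiveB//; last exact: integrable_norm.
by apply: le_normr_Rintegral => //; exact: integrable_sub.
Qed.

(** This is absolute continuity of the integral: [|f|] has small integral over every sufficiently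
    short interval. *)
Lemma continuous_primitive (f : R -> R) : L1 f -> continuous (primitive f).
Proof.
move=> f1 x; apply/cvgrPdist_le => e e0.
have [d [d0 fd]] := integral_normr_continuous f1 e0.
near=> y.
have yx : `|x - y| < d.
  by near: y; exists d => //= z; rewrite /ball/=.
have main a b : a <= b -> b - a < d -> `|primitive f b - primitive f a| <= e.
  move=> ab bad; apply: (le_trans (primitive_dist f1 ab)).
  rewrite primitiveB//; last exact: integrable_norm.
  apply/ltW/fd => //.
  rewrite /= lebesgue_measure_itv/= lte_fin.
  by case: ifP => // _; rewrite -EFinB lte_fin.
have [xy|yx'] := leP x y.
  rewrite distrC; apply: main => //.
  by move: yx; rewrite distrC ger0_norm// subr_ge0.
apply: main; first exact: ltW.
by move: yx; rewrite gtr0_norm// subr_gt0.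
Unshelve. all: by end_near. Qed.

End Integration.

(** * Convolution with a primitive *)

Section ConvolutionPrimitive.
Context {R : realType}.
Local Notation mu := (@lebesgue_measure R).
Local Notation L1 f := (mu.-integrable [set: R] (EFin \o f)).

Lemma EFin_Rintegral (D : set R) (f : R -> R) : measurable D ->
  mu.-integrable D (EFin \o f) ->
  (\int[mu]_(x in D) f x)%:E = (\int[mu]_(x in D) (f x)%:E)%E.
Proof. by move=> mD f1; rewrite fineK//; exact: (integrable_fin_num _ f1). Qed.

Lemma primitive_shift (h : R -> R) (s t : R) : L1 h ->
  primitive (fun r => h (r - s)) t = primitive h (t - s).
Proof.
move=> h1; rewrite /primitive Rintegral_mkcond [RHS]Rintegral_mkcond.
rewrite -[RHS](Rintegral_shift s); last first.
  by apply: integrable_patch => //; exact: (integrable_sub _ h1).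
apply: eq_Rintegral => x _; rewrite !patchE.
congr (if _ then _ else _); apply/idP/idP; rewrite !inE/= !in_itv/=; lra.
Qed.

(** For a point [(r, s)] of the plane, integration over [s] gives the convolution of [kk] and [h] at
    [r], while integration over [r <= t] gives [kk s * primitive h (t - s)]. *)
Let kernel2 (kk h : R -> R) (z : R * R) : R := kk z.2 * h (z.1 - z.2).

Let measurable_kernel2 (kk h : R -> R) : L1 kk -> L1 h ->
  measurable_fun [set: measurableTypeR R * measurableTypeR R] (kernel2 kk h).
Proof.
move=> /measurable_int/measurable_EFinP mk /measurable_int/measurable_EFinP mh.
apply: measurable_funM; first exact: (measurableT_comp mk measurable_snd).
apply: (measurableT_comp mh).
by apply: measurable_funB; [exact: measurable_fst|exact: measurable_snd].
Qed.

(** By Tonelli and translation invariance, the integral of the absolute value is the product of the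
    L1 norms of [kk] and [h]. *)
Let integrable_kernel2 (kk h : R -> R) : L1 kk -> L1 h ->
  (mu \x mu)%E.-integrable
    [set: measurableTypeR R * measurableTypeR R] (EFin \o kernel2 kk h).
Proof.
move=> k1 h1; apply/integrable21ltyP.
  by apply/measurable_EFinP; exact: measurable_kernel2.
have hE s : (\int[mu]_r `|(EFin \o kernel2 kk h) (r, s)| =
    `|kk s|%:E * \int[mu]_r `|h r|%:E)%E.
  have h1s := integrable_norm (integrable_shift s h1).
  under eq_integral do rewrite /= /kernel2/= normrM.
  transitivity (\int[mu]_r ((`|kk s|%:E * `|h (r - s)|%:E)))%E => //.
  rewrite integralZl//; congr (_ * _)%E.
  rewrite -!EFin_Rintegral//; last exact: integrable_norm.
  by congr EFin; apply: (Rintegral_shift s (integrable_norm h1)).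
under eq_integral do rewrite hE.
rewrite -EFin_Rintegral//; last exact: integrable_norm.
rewrite integralZr//; last exact: integrable_norm.
by rewrite -EFin_Rintegral ?ltry//; exact: integrable_norm.
Qed.

Lemma convolution_primitive (kk h : R -> R) : L1 kk -> L1 h ->
  exists2 G : R -> R, L1 G &
    forall t, \int[mu]_s (kk s * primitive h (t - s)) = primitive G t.
Proof.
move=> k1 h1; have f1 := integrable_kernel2 k1 h1.
pose f := EFin \o kernel2 kk h.
pose F : measurableTypeR R -> \bar R := fubini_F mu f.
have F1 : mu.-integrable setT F by exact: integrable_fubini_F.
have mF : measurable_fun setT F by exact: (measurable_int mu F1).
(* The section integral [F] may be infinite on a null set; [fine] replaces it there by 0, which
   changes no integral. *)
have G1 : L1 (fine \o F).
  apply: le_integrable F1 => //.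
    by apply/measurable_EFinP; exact: measurableT_comp.
  by move=> x _ /=; case: (F x) => [r| |]; rewrite //= ?normr0 ?leey.
exists (fine \o F) => // t.
(* Fubini is applied on the half-plane [r <= t]: one iterated integral is the primitive at [t], the
   other is the convolution. *)
pose A : set (measurableTypeR R) := `]-oo, t]%classic.
have mA : measurable (A `*` [set: measurableTypeR R]) 
  by apply: measurableX => //; exact: measurable_itv.
have fA1 : (mu \x mu)%E.-integrable
    [set: measurableTypeR R * measurableTypeR R] (f \_ (A `*` setT)).
  apply: (@integrable_mkcond _ _ _ (mu \x mu)%E _ f mA).1.
  exact: (integrableS measurableT mA _ f1).
have := Fubini fA1.
have -> : (\int[mu]_x \int[mu]_y (f \_ (A `*` setT)) (x, y) =
    (primitive (fine \o F) t)%:E)%E.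
  rewrite /primitive EFin_Rintegral//; last exact: (integrable_sub _ G1).
  transitivity (\int[mu]_(x in A) F x)%E.
    rewrite [RHS]integral_mkcond; apply: eq_integral => x _.
    rewrite patchE; case: ifPn => xA.
      apply: eq_integral => y _; rewrite patchE ifT//.
      by rewrite inE; split => //; rewrite inE in xA.
    rewrite integral0_eq// => y _; rewrite patchE ifF//.
    by apply/negP; rewrite inE => -[/= /mem_set Ax _]; rewrite Ax in xA.
  apply: ae_eq_integral => //.
  - exact: measurable_itv.
  - exact: (measurable_funS measurableT _ mF).
  - exact: (measurable_funS measurableT _ (measurable_int mu G1)).
  - have := integrable_ae measurableT F1; apply: filterS => x Fx _ /=.
    by rewrite fineK//; exact: Fx.
move=> /esym; rewrite -[RHS]/(EFin _) => /(congr1 fine) /= <-.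
congr fine; apply: eq_integral => s _.
rewrite -primitive_shift// EFinM /primitive EFin_Rintegral//; last first.
  exact: (integrable_sub _ (integrable_shift _ h1)).
rewrite -integralZl//; last exact: (integrable_sub _ (integrable_shift _ h1)).
rewrite integral_mkcond; apply: eq_integral => x _; rewrite !patchE.
rewrite /f /kernel2/= -EFinM; congr (if _ then _ else _).
by apply/idP/idP; rewrite !inE /A/=; [move=> ?; split|case].
Qed.

End ConvolutionPrimitive.

(** * Weak derivatives and primitives *)

Section Tent.
Context {R : realType}.
Local Notation mu := (@lebesgue_measure R).
Local Notation L1 f := (mu.-integrable [set: R] (EFin \o f)).

Lemma ge0_Rintegral_gt0 (f : R -> R) (a b c : R) : L1 f ->
  (forall x, 0 <= f x) -> a < b -> 0 < c -> (forall x, a < x < b -> c <= f x) ->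
  0 < \int[mu]_x f x.
Proof.
move=> f1 f0 ab c0 cf.
pose D : set (measurableTypeR R) := `]a, b[%classic.
have mD : measurable D by exact: measurable_itv.
have muD : mu D = (b - a)%:E by rewrite /D/= lebesgue_measure_itv/= lte_fin ab.
have -> : \int[mu]_x f x = \int[mu]_x ((f \_ D) x + (f \_ (~` D)) x).
  apply: eq_Rintegral => x _; rewrite !patchE in_setC.
  by case: (x \in D); rewrite /= ?addr0 ?add0r.
have fD := integrable_patch mD (integrable_sub mD f1).
have mDC := measurableC mD.
have fCD := integrable_patch mDC (integrable_sub mDC f1).
rewrite RintegralD//.
rewrite ltr_pwDl//; last first.
  by apply: Rintegral_ge0 => x _; rewrite patchE; case: ifP.
rewrite -Rintegral_mkcond; apply: (@lt_le_trans _ _ (\int[mu]_(x in D) c)).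
  by rewrite Rintegral_cst// -[X in fine X]/(mu D) muD/= mulr_gt0// subr_gt0.
have muDy : (mu D < +oo)%E by rewrite muD ltry.
apply: le_Rintegral => //.
- apply: measurable_bounded_integrable => //.
  exists c; split; [exact: num_real|move=> M cM x _ /=].
  by rewrite gtr0_norm// ltW.
- exact: integrable_sub.
Qed.

(** A hat of height [e] on [[s, s + 2 * e]], entirely to the right of [s]. It is left unnormalised:
    only the positivity of its integral and its independence of [s] matter. *)
Definition tent (s e x : R) : R := Num.max 0 (e - `|x - (s + e)|).

Lemma tent_ge0 s e x : 0 <= tent s e x.
Proof. by rewrite /tent le_max lexx. Qed.

Lemma tent_le s e x : 0 < e -> tent s e x <= e.
Proof. by move=> e0; rewrite /tent ge_max ltW//= gerBl. Qed.

Lemma tent_out s e x : x <= s \/ s + 2 * e <= x -> tent s e x = 0.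
Proof.
move=> xs; apply/max_idPl; rewrite subr_le0 ler_normr.
by case: xs => xs; apply/orP; [right|left]; lra.
Qed.

Lemma continuous_tent s e : continuous (tent s e).
Proof.
move=> x; apply: (@continuous_max _ _ (fun=> 0) (fun x => e - `|x - (s + e)|)).
  exact: cst_continuous.
apply: continuousB; first exact: cst_continuous.
apply: continuous_comp; last exact: norm_continuous.
by apply: continuousB; [exact: id|exact: cst_continuous].
Qed.

Lemma integrable_tent s e : 0 < e -> L1 (tent s e).
Proof.
move=> e0; have mt : measurable_fun [set: R] (tent s e).
  by apply: continuous_measurable_fun; exact: continuous_tent.
have i1 : L1 (fun x => e * \1_(`[s, s + 2 * e] : set R) x).
  have -> : EFin \o (fun x => e * \1_(`[s, s + 2 * e] : set R) x) =
      (fun x => e%:E * (\1_(`[s, s + 2 * e] : set R) x)%:E)%E by [].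
  apply: integrableZl => //.
  exact: integrable_indic_itv.
apply: (integrable_le mt i1) => x; rewrite ger0_norm ?tent_ge0// indicE.
have [xs|xs] := boolP (x \in _); first by rewrite mulr1 tent_le.
rewrite mulr0 tent_out//; apply/orP.
by move: xs; rewrite notin_setE/= in_itv/= => /negP; lra.
Qed.

Lemma Rintegral_tent_gt0 s e : 0 < e -> 0 < \int[mu]_x tent s e x.
Proof.
(* On the middle half of its support the tent is at least half its height. *)
move=> e0; apply: (@ge0_Rintegral_gt0 _ (s + e / 2) (s + 3 / 2 * e) (e / 2)).
- exact: integrable_tent.
- exact: tent_ge0.
- lra.
- lra.
- move=> x xs; rewrite /tent le_max; apply/orP; right.
  rewrite lerBrDr -lerBrDl ler_norml; lra.
Qed.

Lemma Rintegral_tent_shift s t e : 0 < e ->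
  \int[mu]_x tent s e x = \int[mu]_x tent t e x.
Proof.
move=> e0; rewrite -(Rintegral_shift (t - s) (integrable_tent s e0)).
by apply: eq_Rintegral => x _; rewrite /tent; congr (Num.max _ (_ - `|_|)); lra.
Qed.

Lemma primitive_tent_ge s e x : 0 < e -> s + 2 * e <= x ->
  primitive (tent s e) x = \int[mu]_x tent s e x.
Proof.
move=> e0 xs; rewrite /primitive Rintegral_mkcond; apply: eq_Rintegral => y _.
rewrite patchE; case: ifPn => //; rewrite notin_setE/= in_itv/= => /negP.
by rewrite -ltNge => xy; rewrite tent_out//; right; lra.
Qed.

Lemma primitive_tent_le s e x : x <= s -> primitive (tent s e) x = 0.
Proof.
by move=> xs; apply: primitive_eq0 => y yx; apply: tent_out; left; lra.
Qed.

Lemma primitive_tent_bound s e x : 0 < e ->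
  0 <= primitive (tent s e) x <= \int[mu]_x tent s e x.
Proof.
move=> e0; apply/andP; split; first by apply: Rintegral_ge0 => *; exact: tent_ge0.
rewrite /primitive Rintegral_mkcond; apply: le_Rintegral => //.
- by apply: integrable_patch => //; apply: integrable_sub => //; exact: integrable_tent.
- exact: integrable_tent.
- by move=> y _; rewrite patchE; case: ifP => // _; exact: tent_ge0.
Qed.

Lemma integrableM_tent (V : R -> R) s e : 0 < e -> L1 V ->
  L1 (fun x => V x * tent s e x).
Proof.
move=> e0 V1; apply: (integrableM_bounded (M := e)) => //.
  by apply: continuous_measurable_fun; exact: continuous_tent.
by move=> x; rewrite ger0_norm ?tent_ge0// tent_le.
Qed.

Lemma integrableM_primitive_tent (h : R -> R) s e : 0 < e -> L1 h ->
  L1 (fun x => h x * primitive (tent s e) x).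
Proof.
move=> e0 h1; apply: (integrableM_bounded (M := \int[mu]_x tent s e x)) => //.
  apply: continuous_measurable_fun; apply: continuous_primitive.
  exact: integrable_tent.
by move=> x; have /andP[p0 pI] := primitive_tent_bound s x e0; rewrite ger0_norm.
Qed.

(** The tent vanishes off []s, s + 2 * e[], so only the deviation of [V] from [y] on that interval
    contributes. *)
Lemma tent_average (V : R -> R) (s e y eps : R) : 0 < e -> L1 V ->
  (forall x, s < x < s + 2 * e -> `|V x - y| <= eps) ->
  `|\int[mu]_x (V x * tent s e x) - y * \int[mu]_x tent s e x|
    <= eps * \int[mu]_x tent s e x.
Proof.
move=> e0 V1 Vy; have t1 := integrable_tent s e0.
have Vt := integrableM_tent s e0 V1.
have yt : L1 (fun x => y * tent s e x) by exact: integrableZl t1.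
rewrite -!RintegralZl//.
rewrite -RintegralB//.
have D1 : L1 (fun x => V x * tent s e x - y * tent s e x).
  exact: integrableB Vt yt.
apply: (le_trans (le_normr_Rintegral measurableT D1)).
apply: le_Rintegral => //; [exact: integrable_norm|exact: integrableZl t1|].
move=> x _; rewrite -mulrBl normrM (ger0_norm (tent_ge0 s e x)).
have [xs|xs] := boolP (s < x < s + 2 * e).
  by rewrite ler_wpM2r ?tent_ge0// Vy.
by rewrite tent_out ?mulr0//; apply/orP; lra.
Qed.

(* primitive (tent s e) is a smoothed step at s of height \int tent s e, so the
   error only comes from ]s, s + 2 e]. *)
Lemma primitive_tent_average (h : R -> R) (s e eps : R) : 0 < e -> L1 h ->
  primitive (fun x => `|h x|) (s + 2 * e) - primitive (fun x => `|h x|) s <= eps ->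
  `|\int[mu]_x (h x * primitive (tent s e) x) -
    (\int[mu]_x h x - primitive h s) * \int[mu]_x tent s e x|
    <= eps * \int[mu]_x tent s e x.
Proof.
move=> e0 h1; have t1 := integrable_tent s e0.
set I := \int[mu]_x tent s e x; have I0 : 0 < I by exact: Rintegral_tent_gt0.
have n1 := integrable_norm h1.
have ss : s <= s + 2 * e by lra.
rewrite primitiveB// => hs.
have ht := integrableM_primitive_tent s e0 h1.
pose A : set (measurableTypeR R) := `]-oo, s]%classic.
pose B : set (measurableTypeR R) := `]s, s + 2 * e]%classic.
have mA : measurable A by exact: measurable_itv.
have mB : measurable B by exact: measurable_itv.
have hA : L1 (h \_ A) by apply: integrable_patch => //; exact: integrable_sub.
have hB : L1 ((fun x => `|h x|) \_ B).
  by apply: integrable_patch => //; exact: integrable_sub.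
have hBA : L1 (fun x => h x - (h \_ A) x) 
  by exact: (integrableB measurableT h1 hA).
have hBAI : L1 (fun x => (h x - (h \_ A) x) * I) by exact: integrableMcst.
rewrite /primitive [X in (_ - X) * _]Rintegral_mkcond -RintegralB//.
rewrite -RintegralZr// -RintegralB//.
have D1 : L1 (fun x => h x * primitive (tent s e) x - (h x - (h \_ A) x) * I).
  exact: integrableB ht hBAI.
apply: (le_trans (le_normr_Rintegral measurableT D1)).
apply: (@le_trans _ _ (\int[mu]_x (((fun x => `|h x|) \_ B) x * I))); last first.
  by rewrite RintegralZr// ler_pM2r// -Rintegral_mkcond.
apply: le_Rintegral => //; [exact: integrable_norm|exact: integrableMcst|].
move=> x _; rewrite !patchE.
have xA : (x \in A) = (x <= s) by apply/idP/idP; rewrite inE /A/= in_itv.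
have xB : (x \in B) = (s < x <= s + 2 * e).
  by apply/idP/idP; rewrite inE /B/= in_itv.
rewrite xA xB; have [xs|sx]/= := leP x s.
  by rewrite primitive_tent_le// subrr mulr0 !mul0r subr0 normr0.
rewrite subr0 -mulrBr normrM.
have [xse|xse] := leP x (s + 2 * e); last first.
  by rewrite primitive_tent_ge ?subrr ?normr0 ?mulr0 ?mul0r// ltW.
rewrite ler_wpM2l//.
by have := primitive_tent_bound s x e0; rewrite ler_norml -/I; lra.
Qed.

End Tent.

(** * Recovering a continuous function from its integrable weak derivative *)

Section WeakDerivative.
Context {R : realType}.
Local Notation mu := (@lebesgue_measure R).
Local Notation L1 f := (mu.-integrable [set: R] (EFin \o f)).

Lemma continuous_modulus (f : R -> R) (x eps : R) : {for x, continuous f} ->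
  0 < eps -> exists2 d, 0 < d & forall y, `|y - x| < d -> `|f y - f x| <= eps.
Proof.
move=> /cvgrPdist_le fx eps0; have [d /= d0 fd] := fx _ eps0.
by exists d => // y yx; rewrite distrC; apply: fd; rewrite /ball/= distrC.
Qed.

Lemma derive1_primitive (f : R -> R) (x : R) : L1 f -> {for x, continuous f} ->
  derivable (primitive f) x 1 /\ derive1 (primitive f) x = f x.
Proof.
move=> f1 fx; apply: (@continuous_FTC1 R f -oo%O x (x + 1)) => //.
- by rewrite ltrDl.
- exact: integrable_sub.
- by rewrite ltNyr.
Qed.

Lemma primitive_sub (f g : R -> R) : L1 f -> L1 g ->
  primitive (fun x => f x - g x) = (fun x => primitive f x - primitive g x).
Proof.
move=> f1 g1; apply/funext => x; rewrite /primitive RintegralB//;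
  exact: integrable_sub.
Qed.

(** The two tents have the same integral, so their contributions cancel beyond [t + 2 * e] and the
    primitive has compact support. It is a smoothed indicator of [[s, t]]. *)
Lemma tentB_test_function (a b s t e : R) : 0 < e -> a < s -> s <= t ->
  t + 2 * e < b ->
  test_function a b (primitive (fun x => tent s e x - tent t e x)).
Proof.
move=> e0 as_ st tb; have t1 := integrable_tent s e0.
have t2 := integrable_tent t e0.
set psi := fun x => tent s e x - tent t e x.
have psi1 : L1 psi by exact: (integrableB measurableT t1 t2).
have cpsi : continuous psi.
  by move=> x; apply: continuousB; exact: continuous_tent.
have dpsi x := derive1_primitive psi1 (cpsi x).
have sub : closure [set x | primitive psi x != 0] `<=` `[s, t + 2 * e].
  have /closure_id -> : closed (`[s, t + 2 * e]%classic : set R).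
    exact: interval_closed.
  apply: closure_subset => x /=; rewrite in_itv/=; apply: contraNT.
  rewrite primitive_sub// negb_and -!ltNge => /orP[xs|xt].
    by rewrite !primitive_tent_le ?subrr//; lra.
  by rewrite !primitive_tent_ge ?(Rintegral_tent_shift s t) ?subrr//; lra.
split.
- by move=> x; case: (dpsi x).
- have -> : derive1 (primitive psi) = psi by apply/funext => x; case: (dpsi x).
  exact: cpsi.
- exact: (subclosed_compact (@closed_closure _ _) (@segment_compact _ _ _) sub).
- move=> x /sub/=; rewrite !in_itv/=; lra.
Qed.

(** Tested against the primitive of [tent s e - tent t e], the weak derivative identity becomes,
    after division by the integral of a tent and as [e] tends to 0, the claimed formula. *)
Lemma weak_derivative_primitive (a b : R) (v g : R -> R) :
  mu.-integrable `]a, b[ (EFin \o v) -> mu.-integrable `]a, b[ (EFin \o g) ->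
  {in `]a, b[, continuous v} -> weak_derivative a b v g ->
  forall s t, a < s -> s <= t -> t < b ->
  v t - v s = primitive (g \_ `]a, b[) t - primitive (g \_ `]a, b[) s.
Proof.
move=> v1 g1 cv vg s t as_ st tb.
set h := g \_ `]a, b[; pose V := v \_ `]a, b[.
have h1 : L1 h by exact: integrable_patch.
have V1 : L1 V by exact: integrable_patch.
pose m := primitive (fun x => `|h x|).
have cm : continuous m by apply: continuous_primitive; exact: integrable_norm.
apply/eqP; rewrite -subr_eq0 -normr_eq0; apply/eqP.
set X := (X in `|X|); apply: contrapT => /eqP X0.
have {}X0 : 0 < `|X| by rewrite lt_neqAle eq_sym X0/=.
(* Four averages enter, each with relative error [eps]; this choice yields the contradiction
   [|X| <= |X| / 2]. *)
pose eps := `|X| / 8; have eps0 : 0 < eps by rewrite /eps; lra.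
have sab : s \in `]a, b[ by rewrite in_itv/=; lra.
have tab : t \in `]a, b[ by rewrite in_itv/=; lra.
have [d1 d10 vs] := continuous_modulus (cv s sab) eps0.
have [d2 d20 vt] := continuous_modulus (cv t tab) eps0.
have [d3 d30 ms] := continuous_modulus (cm s) eps0.
have [d4 d40 mt] := continuous_modulus (cm t) eps0.
(* The width [2 * e < d] of a tent must control [v] and [m] near both [s] and [t], and keep the test
   function supported to the left of [b]. *)
pose d := Num.min (Num.min (Num.min d1 d2) (Num.min d3 d4)) (b - t).
have d0 : 0 < d by rewrite !lt_min d10 d20 d30 d40 subr_gt0 tb.
pose e := d / 3; have e0 : 0 < e by rewrite /e; lra.
have : 2 * e < d by rewrite /e; lra.
rewrite !lt_min -!andbA => /and5P[ed1 ed2 ed3 ed4 eb].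
have tbe : t + 2 * e < b by lra.
have {vg} := vg _ (tentB_test_function e0 as_ st tbe).
have t1 := integrable_tent s e0; have t2 := integrable_tent t e0.
set psi := fun x => tent s e x - tent t e x.
have psi1 : L1 psi by exact: (integrableB measurableT t1 t2).
have cpsi : continuous psi.
  by move=> x; apply: continuousB; exact: continuous_tent.
set I := \int[mu]_x tent s e x.
have I0 : 0 < I by exact: Rintegral_tent_gt0.
have IE : \int[mu]_x tent t e x = I by rewrite (Rintegral_tent_shift t s).
have -> : \int[mu]_(x in `]a, b[) (v x * derive1 (primitive psi) x) =
    \int[mu]_x (V x * tent s e x) - \int[mu]_x (V x * tent t e x).
  rewrite -RintegralB//; [|exact: integrableM_tent..].
  rewrite Rintegral_mkcond; apply: eq_Rintegral => x _.
  rewrite /V !patchE (derive1_primitive psi1 (cpsi x)).2 -mulrBr.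
  by case: ifP; rewrite ?mul0r.
have -> : \int[mu]_(x in `]a, b[) (g x * primitive psi x) =
    \int[mu]_x (h x * primitive (tent s e) x) -
    \int[mu]_x (h x * primitive (tent t e) x).
  rewrite -RintegralB//; [|exact: integrableM_primitive_tent..].
  rewrite Rintegral_mkcond; apply: eq_Rintegral => x _.
  rewrite /h !patchE /psi primitive_sub// -mulrBr.
  by case: ifP; rewrite ?mul0r.
have Vclose y x : a < y -> y + 2 * e < b -> y < x < y + 2 * e ->
    V x = v x /\ `|x - y| < 2 * e.
  move=> ay yb yx; split; last by rewrite ltr_norml; lra.
  by rewrite /V patchE ifT// inE/= in_itv/=; lra.
have Vs : forall x, s < x < s + 2 * e -> `|V x - v s| <= eps.
  move=> x sx; have [||-> xs] := Vclose s x _ _ sx; [by []|lra|].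
  by apply: vs; exact: lt_trans xs ed1.
have Vt : forall x, t < x < t + 2 * e -> `|V x - v t| <= eps.
  move=> x tx; have [||-> xt] := Vclose t x _ _ tx; [lra|by []|].
  by apply: vt; exact: lt_trans xt ed2.
have hs : m (s + 2 * e) - m s <= eps.
  apply: le_trans (ler_norm _) _; apply: ms.
  by rewrite addrAC subrr add0r gtr0_norm//; lra.
have ht : m (t + 2 * e) - m t <= eps.
  apply: le_trans (ler_norm _) _; apply: mt.
  by rewrite addrAC subrr add0r gtr0_norm//; lra.
have := primitive_tent_average e0 h1 ht.
have := primitive_tent_average e0 h1 hs.
have := tent_average e0 V1 Vt.
have := tent_average e0 V1 Vs.
rewrite IE -/I !ler_norml.
set A1 := \int[mu]_x (V x * tent s e x); set A2 := \int[mu]_x (V x * tent t e x).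
set B1 := \int[mu]_x _; set B2 := \int[mu]_x (h x * primitive (tent t e) x).
set H := \int[mu]_x h x => h2 h3 h4 h5 h6.
have XI : `|X * I| <= 4 * eps * I by rewrite /X ler_norml; lra.
have : `|X| <= 4 * eps by rewrite -(ler_pM2r I0) -{1}(gtr0_norm I0) -normrM.
rewrite /eps; lra.
Qed.

Lemma W11_primitive (b : R) (v : R -> R) : 0 < b -> W11 0 b v ->
  exists h : R -> R, [/\ L1 h, forall t, t <= 0 -> primitive h t = 0 &
    forall t, 0 <= t <= b -> v t = v 0 + primitive h t].
Proof.
move=> b0 [cv v1 [g [g1 vg]]].
pose h := g \_ `]0, b[.
have h1 : L1 h by exact: integrable_patch.
have h0 t : t <= 0 -> primitive h t = 0.
  move=> t0; apply: primitive_eq0 => y yt.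
  by rewrite /h patchE ifF//; apply/negP; rewrite inE/= in_itv/=; lra.
exists h; split => //.
have [cvo cv0 cvb] := (continuous_within_itvP _ b0).1 cv.
have cvo' : {in `]0, b[, continuous v} by [].
have ch := continuous_primitive h1.
have vE := weak_derivative_primitive v1 g1 cvo' vg.
(* [z] is constant on the open interval; continuity of [v] on the closed one extends this to both
   endpoints. *)
pose z t := v t - primitive h t.
have zE s t : 0 < s < b -> 0 < t < b -> z s = z t.
  move=> sb tb; rewrite /z; have [st|ts] := leP s t.
    by have := vE s t; rewrite -/h => H; have := H _ _ _; lra.
  by have := vE t s; rewrite -/h => H; have := H _ _ _; lra.
have mid : 0 < b / 2 < b by lra.
have z0 : z 0 = z (b / 2).
  have z0' : z t @[t --> 0^'+] --> z 0.
    by apply: cvgB => //; apply: cvg_at_right_filter; exact: ch.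
  have z0'' : z t @[t --> 0^'+] --> z (b / 2).
    apply: cvg_near_cst; near=> t; apply/zE => //.
    by apply/andP; split; near: t; [exact: nbhs_right_gt|exact: nbhs_right_lt].
  exact: (cvg_unique _ z0' z0'').
have zb : z b = z (b / 2).
  have z0' : z t @[t --> b^'-] --> z b.
    by apply: cvgB => //; apply: cvg_at_left_filter; exact: ch.
  have z0'' : z t @[t --> b^'-] --> z (b / 2).
    apply: cvg_near_cst; near=> t; apply/zE => //.
    by apply/andP; split; near: t; [exact: nbhs_left_gt|exact: nbhs_left_lt].
  exact: (cvg_unique _ z0' z0'').
move=> t /andP[t0 tb]; suff : z t = z 0 by rewrite /z (h0 0)//; lra.
move: t0; rewrite le_eqVlt => /predU1P[<-//|t0].
move: tb; rewrite le_eqVlt => /predU1P[->|tb]; first by rewrite zb.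
by rewrite z0; apply: zE => //; rewrite t0.
Unshelve. all: by end_near. Qed.

End WeakDerivative.

(** * Maximum principle *)

Section MaximumPrinciple.
Context {R : realType}.
Local Notation mu := (@lebesgue_measure R).
Local Notation L1 f := (mu.-integrable [set: R] (EFin \o f)).

(** The point [c] is the supremum of the set where [u <= 0]. If [u c > 0], then [u] would be
    positive near [c], where this set accumulates; if [u c < 0], then [u] would be negative just
    after [c]. *)
Lemma last_zero (u : R -> R) (a b : R) : continuous u -> a <= b -> 0 < u b ->
  (forall x, a <= x <= b -> 0 < u x) \/
  exists c, [/\ a <= c <= b, u c = 0 & forall x, c < x <= b -> 0 < u x].
Proof.
move=> cu ab ub; pose Z := [set x | a <= x <= b /\ u x <= 0].
have [Z0|/set0P Z0] := eqVneq Z set0.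
  left=> x xab; rewrite ltNge; apply/negP => ux0.
  by have : Z x by []; rewrite Z0.
right.
have Zb : ubound Z b by move=> x [/andP[]].
have Zsup : has_sup Z by split => //; exists b.
pose c := sup Z; exists c.
have cb : c <= b by apply: ge_sup.
have ac : a <= c.
  have [x Zx] := Z0; apply: (@le_trans _ _ x); first by case: Zx => /andP[].
  by apply: ub_le_sup => //; exists b.
have after x : c < x <= b -> 0 < u x.
  move=> /andP[cx xb]; rewrite ltNge; apply/negP => ux.
  have : x <= c by apply: ub_le_sup; [exists b|split => //; lra].
  lra.
have uc_le : u c <= 0.
  rewrite leNgt; apply/negP => uc; have uc2 : 0 < u c / 2 by lra.
  have [d d0 ud] := continuous_modulus (cu c) uc2.
  have [x [xab ux] cx] := sup_adherent d0 Zsup.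
  have xc : x <= c by apply: ub_le_sup => //; exists b.
  have : `|x - c| < d by rewrite ltr_norml; move: cx; rewrite -/c; lra.
  by move=> /ud; rewrite ler_norml; lra.
have cb' : c < b.
  by rewrite lt_neqAle cb andbT; apply/eqP => cbE; move: uc_le; rewrite cbE; lra.
split => //; first by rewrite ac.
apply/eqP; rewrite eq_le uc_le/= leNgt; apply/negP => uc.
have uc2 : 0 < - u c / 2 by lra.
have [d d0 ud] := continuous_modulus (cu c) uc2.
pose x := Num.min b (c + d / 2).
have xb : x <= b by rewrite ge_min lexx.
have xd : x <= c + d / 2 by rewrite ge_min lexx orbT.
have cx : c < x by rewrite lt_min cb' ltrDl; lra.
have ux : 0 < u x by apply: after; rewrite cx.
have : `|x - c| < d by rewrite ltr_norml; lra.
by move=> /ud; rewrite ler_norml; lra.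
Qed.

(** The domain of integration does not depend on [t], so increments in [t] are integrals of
    differences of kernels. Causality comes from kernels that vanish on []-oo, 0]]. *)
Definition convT (kk y : R -> R) (t : R) : R := \int[mu]_s (kk (t - s) * y s).

Context (kk : R -> R).
Context (kk1 : L1 kk) (kk_ge0 : forall x, 0 <= kk x)
  (kk_le0 : forall x, x <= 0 -> kk x = 0)
  (kk_dec : forall s t, 0 < s -> s <= t -> kk t <= kk s).

Lemma integrable_conv (y : R -> R) (M t : R) : measurable_fun [set: R] y ->
  (forall x, `|y x| <= M) -> L1 (fun s => kk (t - s) * y s).
Proof.
move=> my yM; apply: integrableM_bounded my yM.
exact: (integrable_reflect _ kk1).
Qed.

Context (h u : R -> R) (c : R) (h1 : L1 h).
Context (uE : u = (fun x => c + primitive h x)).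
Let p x := Num.max 0 (u x).
Let m := primitive (fun x => `|h x|).

Let nh1 : L1 (fun x => `|h x|). Proof. exact: integrable_norm. Qed.

Let cu : continuous u.
Proof.
rewrite uE => x; apply: continuousD; first exact: cst_continuous.
exact: continuous_primitive.
Qed.

Let cp : continuous p.
Proof.
move=> x; apply: (@continuous_max _ _ (fun=> 0) u); last exact: cu.
exact: cst_continuous.
Qed.

Let u_bound x : `|u x| <= `|c| + \int[mu]_x `|h x|.
Proof.
rewrite uE; apply: (le_trans (ler_normD _ _)); rewrite lerD2l.
exact: primitive_bound.
Qed.

Let p_bound x : `|p x| <= `|c| + \int[mu]_x `|h x|.
Proof.
apply: le_trans (u_bound x); rewrite /p.
have [u0|u0] := leP 0 (u x); first by [].
by rewrite normr0.
Qed.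

Let conv_u t : L1 (fun s => kk (t - s) * u s).
Proof.
by apply: (integrable_conv _ _ u_bound); exact: continuous_measurable_fun.
Qed.

Let conv_p t : L1 (fun s => kk (t - s) * p s).
Proof.
by apply: (integrable_conv _ _ p_bound); exact: continuous_measurable_fun.
Qed.

Let p_ge0 x : 0 <= p x. Proof. by rewrite /p le_max lexx. Qed.

Let u_dist a b : a <= b -> `|u b - u a| <= m b - m a.
Proof.
move=> ab; have -> : u b - u a = primitive h b - primitive h a by rewrite uE; lra.
exact: primitive_dist.
Qed.

(* Where u is positive its negative part vanishes, and on the past this part is
   weighted by a kernel which decreases with time; hence the convolution with
   max(0, u) grows no faster than the one with u. *)
Let conv_pos_le a b : a <= b -> u a = 0 \/ 0 < u a ->
  (forall x, a < x < b -> 0 < u x) ->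
  convT kk p b - convT kk p a <= convT kk u b - convT kk u a.
Proof.
move=> ab ua uab; rewrite /convT -!RintegralB//.
apply: le_Rintegral => //.
- exact: (integrableB measurableT (conv_p b) (conv_p a)).
- exact: (integrableB measurableT (conv_u b) (conv_u a)).
move=> s _; rewrite -subr_ge0.
have -> : kk (b - s) * u s - kk (a - s) * u s - (kk (b - s) * p s - kk (a - s) * p s)
    = (kk (a - s) - kk (b - s)) * (p s - u s) by ring.
have pu : 0 <= p s - u s by rewrite subr_ge0 /p le_max lexx orbT.
have pu0 : 0 <= u s -> p s - u s = 0.
  by move=> us; rewrite /p max_r ?subrr.
have [sa|as_] := ltP s a.
  by rewrite mulr_ge0// subr_ge0 kk_dec; lra.
have [sb|bs] := ltP s b.
  rewrite pu0 ?mulr0//; move: as_; rewrite le_eqVlt => /predU1P[<-|as_].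
    by case: ua => [->|/ltW].
  by apply/ltW/uab; rewrite as_.
by rewrite !kk_le0 ?subrr ?mul0r// subr_le0.
Qed.

(** The times [s < a] contribute at most 0 to the increment because the kernel decreases; on
    [[a, b]] the integrand is at most [d * kk (b - s)]. *)
Let conv_pos_zero a b d : a <= b -> (forall s, a <= s <= b -> p s <= d) ->
  convT kk p b - convT kk p a <= d * primitive kk (b - a).
Proof.
move=> ab pd; rewrite /convT -!RintegralB//.
rewrite /primitive [X in _ <= _ * X]Rintegral_mkcond.
have k1 : L1 (kk \_ `]-oo, b - a]).
  by apply: integrable_patch => //; exact: (integrable_sub _ kk1).
(* The substitution of [b - s] for the variable puts both sides under integrals in [s], to be
   compared pointwise. *)
rewrite -(Rintegral_reflect b k1) -RintegralZl//; last exact: integrable_reflect.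
apply: le_Rintegral => //.
- exact: (integrableB measurableT (conv_p b) (conv_p a)).
- have := integrableMcst d (integrable_reflect b k1).
  by apply: eq_integrable => // x _ /=; rewrite mulrC.
move=> s _; rewrite patchE.
have -> : (b - s \in `]-oo, b - a]%classic) = (a <= s).
  by apply/idP/idP; rewrite inE/= in_itv/=; lra.
have [sa|as_] /= := leP a s; last first.
  rewrite mulr0 -mulrBl mulr_le0_ge0// subr_le0 kk_dec; lra.
rewrite (kk_le0 (x := a - s)) ?mul0r ?subr0; last by rewrite subr_le0.
have [sb|bs] := leP s b.
  by rewrite mulrC ler_wpM2r// pd// sa.
by rewrite kk_le0 ?mul0r ?mulr0//; lra.
Qed.

Context (T : R) (u_le0 : forall x, x <= 0 -> u x <= 0).
Context (u_dec : forall a b, 0 <= a -> a <= b -> b <= T ->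
  (forall x, a < x < b -> 0 < u x) -> convT kk u b <= convT kk u a).

Let m_le a b : a <= b -> m a <= m b.
Proof. by move=> ab; apply: ge0_primitive_le. Qed.

(** Up to the last zero of [u] the bound comes from [conv_pos_zero]; after it, [conv_pos_le] and
    [u_dec] make the increment nonpositive. The form of the bound suits summation: [m] telescopes
    and the other factor depends on the length only. *)
Let step a b : 0 <= a -> a <= b -> b <= T ->
  convT kk p b - convT kk p a <= (m b - m a) * primitive kk (b - a).
Proof.
move=> a0 ab bT.
have K0 x : 0 <= primitive kk x by apply: Rintegral_ge0.
(* Since [u e <= 0], every [s] in [[a, e]] satisfies [u s <= u s - u e <= m e - m s <= m b - m
   a]. *)
have zero e : a <= e -> e <= b -> u e <= 0 ->
    convT kk p e - convT kk p a <= (m b - m a) * primitive kk (b - a).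
  move=> ae eb ue; apply: (@le_trans _ _ ((m b - m a) * primitive kk (e - a))).
    apply: conv_pos_zero => // s /andP[as_ se].
    rewrite /p ge_max subr_ge0 m_le//=.
    have := u_dist se; rewrite ler_norml.
    have := m_le as_; have := m_le eb; lra.
  rewrite ler_wpM2l// ?subr_ge0 ?m_le//.
  by apply: ge0_primitive_le => //; lra.
have [ub|ub] := leP (u b) 0; first exact: zero.
have [pos|[e [/andP[ae eb] ue pos]]] := last_zero cu ab ub.
  have H : convT kk p b - convT kk p a <= convT kk u b - convT kk u a.
    by apply: conv_pos_le => [//||x xab]; [right|]; apply: pos; lra.
  have H2 : convT kk u b <= convT kk u a.
    by apply: u_dec => // x xab; apply: pos; lra.
  have : 0 <= (m b - m a) * primitive kk (b - a).
    by rewrite mulr_ge0// subr_ge0 m_le.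
  lra.
have H : convT kk p b - convT kk p e <= convT kk u b - convT kk u e.
  by apply: conv_pos_le => [//||x xab]; [left|apply: pos; lra].
have H2 : convT kk u b <= convT kk u e.
  by apply: u_dec => //; [lra|move=> x xab; apply: pos; lra].
have := zero e ae eb; rewrite ue lexx => /(_ isT); lra.
Qed.

Let conv_pos0 : convT kk p 0 = 0.
Proof.
apply: Rintegral_eq0 => s _; have [s0|s0] := leP s 0.
  by rewrite /p max_l ?mulr0// u_le0.
by rewrite kk_le0 ?mul0r//; lra.
Qed.

Lemma conv_pos_le0 t : 0 <= t <= T -> convT kk p t <= 0.
Proof.
move=> /andP[t0 tT]; apply/ler_addgt0Pr => eps eps0; rewrite add0r.
have M0 : 0 <= m t - m 0 by rewrite subr_ge0 m_le.
(* The summand 1 makes [M] positive even if [m t = m 0]. *)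
pose M := m t - m 0 + 1; have M1 : 0 < M by rewrite /M; lra.
have epsM : 0 < eps / M by exact: divr_gt0.
have [d d0 kd] := continuous_modulus (continuous_primitive kk1 (x := 0)) epsM.
have K0 : primitive kk 0 = 0 by apply: primitive_eq0.
have [n nt] : exists n : nat, t / d < n%:R.
  by exists (Num.bound (t / d)); apply: archi_boundP; rewrite divr_ge0// ltW.
have n0 : (0 : R) < n%:R by apply: le_lt_trans nt; rewrite divr_ge0// ltW.
pose e := t / n%:R.
have e0 : 0 <= e by rewrite divr_ge0// ltW.
have ed : e < d by rewrite /e ltr_pdivrMr// mulrC -ltr_pdivrMr.
have Ke : primitive kk e <= eps / M.
  have := kd e; rewrite subr0 ger0_norm// => /(_ ed); rewrite K0 subr0.
  exact: le_trans (ler_norm _).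
(* All steps share the factor [primitive kk e <= eps / M], and the increments of [m] telescope to at
   most [M]. *)
have sumle i : (i <= n)%N ->
    convT kk p (i%:R * e) <= (m (i%:R * e) - m 0) * (eps / M).
  elim: i => [_|i IH iN]; first by rewrite !mul0r conv_pos0 subrr mul0r.
  have {IH} := IH (ltnW iN).
  have ie : 0 <= i%:R * e by rewrite mulr_ge0.
  have iS : i.+1%:R * e = i%:R * e + e by rewrite -natr1; ring.
  have iT : i.+1%:R * e <= T.
    apply: le_trans tT; rewrite /e mulrA ler_pdivrMr// mulrC ler_wpM2l//.
    by rewrite ler_nat.
  have : convT kk p (i.+1%:R * e) - convT kk p (i%:R * e) <=
      (m (i.+1%:R * e) - m (i%:R * e)) * (eps / M).
    apply: (le_trans (step ie _ iT)); first by rewrite iS lerDl.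
    have -> : i.+1%:R * e - i%:R * e = e by rewrite iS; ring.
    by rewrite ler_wpM2l// subr_ge0 m_le// iS lerDl.
  lra.
have := sumle n (leqnn n).
have -> : n%:R * e = t by rewrite /e mulrC divfK// gt_eqF.
move=> /le_trans; apply; rewrite mulrA ler_pdivrMr// mulrC ler_wpM2l ?(ltW eps0)//.
by rewrite /M; lra.
Qed.

(** If [u t > 0], then just before [t] both [p] and the kernel are bounded below by positive
    constants, so the convolution at [t] is positive, against [conv_pos_le0]. *)
Lemma maximum_principle : (forall x, 0 < x -> exists2 s, 0 < s < x & 0 < kk s) ->
  forall t, 0 <= t <= T -> u t <= 0.
Proof.
move=> kk_gt0 t tT; rewrite leNgt; apply/negP => ut.
have ut2 : 0 < u t / 2 by lra.
have [d d0 ud] := continuous_modulus (@cu t) ut2.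
have [s /andP[s0 sd] kks] := kk_gt0 _ d0.
have : 0 < convT kk p t.
  apply: (@ge0_Rintegral_gt0 _ _ (t - s) t (kk s * (u t / 2))).
  - exact: conv_p.
  - by move=> x; rewrite mulr_ge0.
  - by rewrite ltrBlDr ltrDl.
  - exact: mulr_gt0.
  move=> x xt; have : `|x - t| < d by rewrite ltr_norml; lra.
  move=> /ud; rewrite ler_norml => ux.
  apply: ler_pM; [exact: ltW|exact: ltW|by apply: kk_dec; lra|].
  by rewrite /p le_max; apply/orP; right; lra.
by rewrite ltNge conv_pos_le0.
Qed.

End MaximumPrinciple.

(** * Kernels of class PC *)

Section KernelPC.
Context {R : realType}.
Local Notation mu := (@lebesgue_measure R).
Local Notation L1 f := (mu.-integrable [set: R] (EFin \o f)).

Lemma ae_le0_Rintegral (D : set (measurableTypeR R)) (g : R -> R) :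
  measurable D -> mu.-integrable D (EFin \o g) ->
  {ae mu, forall x, D x -> g x <= 0} -> \int[mu]_(x in D) g x <= 0.
Proof.
move=> mD g1 g0.
have ng1 : mu.-integrable D (EFin \o (fun x => - `|g x|)).
  exact: integrableN (integrable_norm g1).
(* Replacing [g] by [-|g|], which agrees with it almost everywhere on [D], turns the bound into a
   pointwise one. *)
have -> : \int[mu]_(x in D) g x = \int[mu]_(x in D) (- `|g x|).
  congr fine; apply: ae_eq_integral => //.
  - exact: (measurable_int mu g1).
  - exact: (measurable_int mu ng1).
  apply: filterS g0 => x gx Dx /=.
  by rewrite ler0_norm ?opprK// gx.
rewrite -[leRHS](_ : \int[mu]_(x in D) (0 : R) = 0); last first.
  by rewrite Rintegral_cst// mul0r.
by apply: le_Rintegral => //; exact: integrable0.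
Qed.

Context (k l : R -> R) (T : R) (T_gt0 : 0 < T) (kl_PC : PC k l).

(* PC leaves k 0 arbitrary, hence the left-open interval. *)
Definition truncated_kernel : R -> R := k \_ `]0, T].
Let kk := truncated_kernel.

Let kkE x : kk x = if 0 < x <= T then k x else 0.
Proof.
rewrite /kk/truncated_kernel patchE; congr (if _ then _ else _).
by apply/idP/idP; rewrite inE/= in_itv.
Qed.

Lemma integrable_truncated_kernel : L1 kk.
Proof.
have [kloc _ _ _ _] := kl_PC.
have k1 : mu.-integrable `[0, T] (EFin \o k).
  apply: kloc; first exact: segment_compact.
  by move=> x /=; rewrite !in_itv/= andbT => /andP[].
apply: integrable_patch => //.
apply: integrableS k1 => //.
by move=> x /=; rewrite !in_itv/= => /andP[/ltW-> ->].
Qed.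

Lemma truncated_kernel_ge0 x : 0 <= kk x.
Proof.
have [_ k0 _ _ _] := kl_PC.
by rewrite kkE; case: ifP => // /andP[x0 _]; exact: k0.
Qed.

Lemma truncated_kernel_le0 x : x <= 0 -> kk x = 0.
Proof. by move=> x0; rewrite kkE ltNge x0. Qed.

Lemma truncated_kernel_dec s t : 0 < s -> s <= t -> kk t <= kk s.
Proof.
have [_ _ kdec _ _] := kl_PC.
move=> s0 st; rewrite [leLHS]kkE; case: ifP => [/andP[t0 tT]|_].
  by rewrite kkE s0 (le_trans st tT)/= kdec.
exact: truncated_kernel_ge0.
Qed.

(** A kernel vanishing on []0, x[] would give [k * l] the value 0 at small times, instead of 1. *)
Lemma truncated_kernel_gt0 x : 0 < x -> exists2 s, 0 < s < x & 0 < kk s.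
Proof.
move=> x0; apply: contrapT => no.
have kk0 s : 0 < s < x -> kk s = 0.
  move=> sx; apply/eqP; rewrite eq_le truncated_kernel_ge0 andbT leNgt.
  by apply/negP => ks; apply: no; exists s.
have [_ _ _ _ kl1] := kl_PC.
pose d := Num.min x T / 2.
have m0 : 0 < Num.min x T by rewrite lt_min x0.
have mx : Num.min x T <= x by rewrite ge_min lexx.
have mT : Num.min x T <= T by rewrite ge_min lexx orbT.
have d0 : 0 < d by rewrite /d; lra.
(* The endpoint [s = d] is excluded, since the value [k 0] is arbitrary. *)
have zero s : s \in `[0, d[%classic -> k (d - s) * l s = 0.
  rewrite inE/= in_itv/= => sd; have := kk0 (d - s).
  rewrite kkE ifT; last by rewrite /d in sd *; lra.
  by move=> ->; [rewrite mul0r|rewrite /d in sd *; lra].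
have := kl1 _ d0; rewrite /convolution -Rintegral_itv_bndo_bndc.
  have -> : \int[mu]_(s in `[0, d[) (k (d - s) * l s) = \int[mu]_(s in `[0, d[) (0 : R).
    exact: eq_Rintegral.
  by rewrite Rintegral_cst// mul0r => /eqP; rewrite eq_sym oner_eq0.
have i0 : mu.-integrable `[0, d[ (fun=> 0%E) by exact: integrable0.
by apply: eq_integrable i0 => // s sd /=; rewrite zero.
Qed.

(** The kernel cuts off [s >= t] and [y] cuts off [s < 0]. At the single point [s = t] the two
    integrands may differ, which is a null set. *)
Lemma convolutionE (x y : R -> R) (t : R) : t <= T ->
  (forall s, 0 <= s < t -> x s = y s) -> (forall s, s < 0 -> y s = 0) ->
  L1 (fun s => kk (t - s) * y s) -> convolution k x t = convT kk y t.
Proof.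
move=> tT xy y0 y1.
have E s : s \in `[0, t[%classic -> k (t - s) * x s = kk (t - s) * y s.
  rewrite inE/= in_itv/= => st; rewrite xy// kkE ifT//; lra.
rewrite /convolution -Rintegral_itv_bndo_bndc; last first.
  have := integrable_sub (measurable_itv `[0, t[) y1.
  by apply: eq_integrable => // s st /=; rewrite E.
rewrite Rintegral_mkcond; apply: eq_Rintegral => s _.
rewrite patchE; case: ifPn => [|]; first exact: E.
rewrite notin_setE/= in_itv/= => /negP; have [s0|s0] := ltP s 0.
  by rewrite y0 ?mulr0.
by rewrite -leNgt => ts; rewrite truncated_kernel_le0 ?mul0r// subr_le0.
Qed.

Lemma integrable_conv_primitive (h : R -> R) (t : R) : L1 h ->
  L1 (fun s => kk (t - s) * primitive h s).
Proof.
move=> h1; apply: (integrable_conv integrable_truncated_kernel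
  (M := \int[mu]_x `|h x|)).
  by apply: continuous_measurable_fun; exact: continuous_primitive.
by move=> x; exact: primitive_bound.
Qed.

(** [convolution_primitive] exhibits the convolution as a primitive of [G], and Lebesgue
    differentiation then identifies its derivative almost everywhere. *)
Lemma W11_convolution (v : R -> R) : W11 0 T v ->
  exists h G : R -> R, [/\ L1 h /\ L1 G,
    forall t, t <= 0 -> primitive h t = 0,
    forall t, 0 <= t <= T -> v t = v 0 + primitive h t,
    forall t, convT kk (primitive h) t = primitive G t &
    {ae mu, forall t, 0 < t < T ->
      derive1 (convolution k (fun s => v s - v 0)) t = G t}].
Proof.
move=> /(W11_primitive T_gt0)[h [h1 h0 vE]].
have [G G1 GE] := convolution_primitive integrable_truncated_kernel h1.
have conv t : convT kk (primitive h) t = primitive G t.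
  rewrite -GE /convT -[LHS](Rintegral_reflect t); last first.
    exact: integrable_conv_primitive.
  by apply: eq_Rintegral => s _; rewrite opprB addrCA subrr addr0.
exists h, G; split => //.
have Gy y : mu.-integrable `]-oo, y] (EFin \o G) by exact: integrable_sub.
have Gloc : locally_integrable [set: R] G.
  by apply: open_integrable_locally => //; exact: openT.
have := FTC1Ny Gy Gloc.
apply: filterS; first exact: (ae_filter_ringOfSetsType mu).
move=> t [dG GtE] tT.
(* The convolution of [v - v 0] is known to agree with [primitive G] only up to time [T]; a
   neighbourhood of [t < T] suffices for the derivative. *)
rewrite -GtE !derive1E; apply: near_eq_derive => //.
near=> x.
rewrite -[RHS]conv; apply: convolutionE => //.
- by apply: ltW; near: x; apply: lt_nbhsl; case/andP: tT.
- move=> s sx; rewrite vE; first by rewrite addrC addKr.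
  have xT : x <= T by apply: ltW; near: x; apply: lt_nbhsl; case/andP: tT.
  by lra.
- by move=> s /ltW; exact: h0.
- exact: integrable_conv_primitive.
Unshelve. all: by end_near. Qed.

End KernelPC.

(** * Comparison of subsolutions and supersolutions *)

Theorem lemma2p6 (R : realType) (T : R) (k l f v w : R -> R)
  (T_gt0 : 0 < T)
  (kl_PC : PC k l)
  (f_cont : continuous f)
  (f_nondecreasing : {homo f : x y / x <= y})
  (v_W11 : W11 0 T v)
  (w_W11 : W11 0 T w)
  (vw0 : v 0 <= w 0)
  (v_sub : {ae (@lebesgue_measure R), forall t : R, 0 < t < T ->
     derive1 (convolution k (fun s : R => v s - v 0)) t + f (v t) <= 0})
  (w_super : {ae (@lebesgue_measure R), forall t : R, 0 < t < T ->
     0 <= derive1 (convolution k (fun s : R => w s - w 0)) t + f (w t)}) :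
  forall t : R, 0 <= t <= T -> v t <= w t.
Proof.
have k1 := integrable_truncated_kernel T kl_PC.
have [hv [Gv [[hv1 Gv1] hv0 vE convv dv]]] := W11_convolution T_gt0 kl_PC v_W11.
have [hw [Gw [[hw1 Gw1] hw0 wE convw dw]]] := W11_convolution T_gt0 kl_PC w_W11.
set mu := (@lebesgue_measure R) in v_sub w_super dv dw *.
pose c := v 0 - w 0.
pose h x := hv x - hw x.
have h1 : mu.-integrable [set: R] (EFin \o h).
  exact: (integrableB measurableT hv1 hw1).
(* This extends [v - w] from [[0, T]] to the line, with the constant value [c <= 0] at negative
   times. *)
pose u x := c + primitive h x.
have hE x : primitive h x = primitive hv x - primitive hw x.
  by rewrite /h primitive_sub.
have uvw t : 0 <= t <= T -> u t = v t - w t.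
  by move=> tT; rewrite /u hE /c (vE t)// (wE t)//; ring.
(* Over the whole line the convolution with the constant [c] does not depend on [t], so it drops out
   of increments; this plays the part of subtracting the initial value. *)
have convE t : convT (truncated_kernel k T) u t =
    (\int[mu]_s truncated_kernel k T s) * c + (primitive Gv t - primitive Gw t).
  have ic : mu.-integrable [set: R]
      (EFin \o (fun s => truncated_kernel k T (t - s) * c)).
    by apply: integrableMcst; exact: integrable_reflect.
  have iv := integrable_conv_primitive T kl_PC t hv1.
  have iw := integrable_conv_primitive T kl_PC t hw1.
  have ivw := integrableB measurableT iv iw.
  rewrite -convv -convw /convT -(Rintegral_reflect t k1).
  rewrite -RintegralZr//; last exact: integrable_reflect.
  rewrite -RintegralB// -RintegralD//.
  by apply: eq_Rintegral => s _; rewrite /u hE; ring.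
have u_le0 x : x <= 0 -> u x <= 0.
  by move=> x0; rewrite /u hE hv0// hw0// /c; lra.
have u_dec a b : 0 <= a -> a <= b -> b <= T -> (forall x, a < x < b -> 0 < u x) ->
    convT (truncated_kernel k T) u b <= convT (truncated_kernel k T) u a.
  move=> a0 ab bT uab; rewrite !convE lerD2l.
  have GE x : primitive Gv x - primitive Gw x =
      primitive (fun x => Gv x - Gw x) x by rewrite primitive_sub.
  rewrite !GE -subr_le0.
  have G1 : mu.-integrable [set: R] (EFin \o (fun x => Gv x - Gw x)).
    exact: (integrableB measurableT Gv1 Gw1).
  (* On the open interval [u > 0], that is [w < v], so that almost everywhere
     [Gv - Gw <= f (w x) - f (v x) <= 0]. *)
  rewrite primitiveB// -Rintegral_itv_bndo_bndc; last exact: integrable_sub.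
  apply: ae_le0_Rintegral => //; first exact: integrable_sub.
  near=> x => /=; rewrite in_itv/= => /andP[ax xb].
  have xT : 0 < x < T by lra.
  have xT' : 0 <= x <= T by lra.
  have fwv : f (w x) <= f (v x).
    by apply: f_nondecreasing; have := uab x; rewrite uvw// ax xb => /(_ isT); lra.
  have : derive1 (convolution k (fun s : R => v s - v 0)) x + f (v x) <= 0.
    by move: xT; near: x.
  have : 0 <= derive1 (convolution k (fun s : R => w s - w 0)) x + f (w x).
    by move: xT; near: x.
  have -> : derive1 (convolution k (fun s : R => v s - v 0)) x = Gv x.
    by move: xT; near: x.
  have -> : derive1 (convolution k (fun s : R => w s - w 0)) x = Gw x.
    by move: xT; near: x.
  lra.
move=> t tT.
have : u t <= 0.
  exact: (maximum_principle k1 (truncated_kernel_ge0 T kl_PC)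
    (@truncated_kernel_le0 _ k T) (truncated_kernel_dec T kl_PC) h1 erefl u_le0 u_dec
    (truncated_kernel_gt0 T_gt0 kl_PC) tT).
by rewrite uvw//; lra.
Unshelve. all: by end_near. Qed.
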